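(* Let $G$ be a finite simple undirected graph of diameter $d$ and let $D\subseteq\{0,1,\ldots,d\}$ be nonempty with $D\ne\{0\}$. If $G$ contains a vertex $x$ with $N_D(x)=\emptyset$, then $G$ is not $D$-distance magic.
   Context: Let $G=(V,E)$ be a finite simple undirected graph with $v=|V|$ vertices, and let $d(x,y)$ be the graph distance (vertices in different connected components are at infinite distance; for a non-connected graph, $d$ denotes the largest diameter of a connected component). For a set $D$ of nonnegative integers and $x\in V$, put $N_D(x)=\{y\in V : d(x,y)\in D\}$. A $D$-distance magic labeling of $G$ is a bijection $f:V\to\{1,2,\ldots,v\}$ for which there is a constant $\mathsf{k}$ such that $\sum_{y\in N_D(x)} f(y)=\mathsf{k}$ for every $x\in V$ (an empty sum is $0$). $G$ is called $D$-distance magic if it admits a $D$-distance magic labeling. *)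

(* Defs.v *)
(* A finite simple undirected graph is a finite vertex type
   [T : finType] with a symmetric irreflexive adjacency relation [e : rel T]. *)
From mathcomp Require Import all_boot.

Set Implicit Arguments.
Unset Strict Implicit.
Unset Printing Implicit Defensive.

Section Graph.

Variables (T : finType) (e : rel T).

Definition has_walk (n : nat) (x y : T) : bool :=
  [exists p : n.-tuple T, path e x p && (last x p == y)].

Lemma connect_has_walk (x y : T) : connect e x y -> exists n, has_walk n x y.
Proof.
case/connectP=> p xp ->; exists (size p).
by apply/existsP; exists (in_tuple p); rewrite xp eqxx.
Qed.

(* The value [None] stands for infinite distance. *)
Definition dist (x y : T) : option nat :=
  if @idP (connect e x y) is ReflectT xy
  then Some (ex_minn (connect_has_walk xy)) else None.

(* When [e] is symmetric, [connect e] is an equivalence relation. *)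
Definition components : {set {set T}} :=
  equivalence_partition (connect e) [set: T].

(* The default 0 is never used: vertices of one component are at finite
   distance. *)
Definition component_diameter (C : {set T}) : nat :=
  \max_(x in C) \max_(y in C) odflt 0 (dist x y).

Definition diameter : nat := \max_(C in components) component_diameter C.

Definition nbhd (D : {pred nat}) (x : T) : {set T} :=
  [set y | if dist x y is Some n then n \in D else false].

Definition labeling (f : T -> nat) : Prop :=
  injective f /\ (forall i : nat, 1 <= i <= #|T| <-> exists x : T, f x = i).

Definition distance_magic_labeling (D : {pred nat}) (f : T -> nat) : Prop :=
  labeling f /\
  exists k : nat, forall x : T, \sum_(y in nbhd D x) f y = k.

Definition distance_magic (D : {pred nat}) : Prop :=
  exists f : T -> nat, distance_magic_labeling D f.

End Graph.

(* Main.v *)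
Require Import Defs.
From mathcomp Require Import all_boot.

(** Labels are positive, so a set of vertices with label sum 0 is empty. A vertex
with empty [D]-neighbourhood forces the magic constant to be 0, hence makes
every [D]-neighbourhood empty ([magic_nbhd0]). But an element [i] of [D] is at
most the diameter, and every such [i] is the distance between two vertices
([dist_surj]): cutting a shortest walk between two vertices at distance at least
[i] after [i] steps yields a vertex at distance exactly [i] from its start
([dist_initial]). That vertex lies in a [D]-neighbourhood, a contradiction. *)

Section Distance.

Set Implicit Arguments.
Unset Strict Implicit.

Variables (T : finType) (e : rel T).

Lemma has_walkP (n : nat) (x y : T) :
  reflect (exists p, [/\ size p = n, path e x p & last x p = y])
          (has_walk e n x y).
Proof.
apply: (iffP existsP) => [[p /andP[xp /eqP yp]] | [p [<- xp <-]]].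
  by exists p; rewrite size_tuple.
by exists (in_tuple p); rewrite xp eqxx.
Qed.

Lemma has_walkD (m n : nat) (x z : T) :
  has_walk e (m + n) x z <-> exists2 y, has_walk e m x y & has_walk e n y z.
Proof.
split=> [/has_walkP[p [sz_p xp zp]] | [y]].
  move: xp zp; rewrite -(cat_take_drop m p) cat_path last_cat.
  move=> /andP[xp1 xp2] zp; exists (last x (take m p)); apply/has_walkP.
    by exists (take m p); rewrite size_takel // sz_p leq_addr.
  by exists (drop m p); rewrite size_drop sz_p addKn.
move=> /has_walkP[p [<- xp <-]] /has_walkP[q [<- xq <-]].
by apply/has_walkP; exists (p ++ q); rewrite size_cat cat_path last_cat xp.
Qed.

Lemma dist_has_walk (n : nat) (x y : T) :
  has_walk e n x y -> exists2 m, dist e x y = Some m & m <= n.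
Proof.
move=> xy_n; rewrite /dist; case: {-}_ / idP => [xy | []].
  by case: ex_minnP => m _ min_m; exists m; rewrite ?min_m.
by have /has_walkP[p [_ xp <-]] := xy_n; apply/connectP; exists p.
Qed.

Lemma dist_Some (n : nat) (x y : T) :
  dist e x y = Some n ->
  has_walk e n x y /\ forall m, has_walk e m x y -> n <= m.
Proof.
rewrite /dist; case: {-}_ / idP => // xy [<-].
by case: ex_minnP.
Qed.

Lemma dist_refl (x : T) : dist e x x = Some 0.
Proof.
have /dist_has_walk[m ->]: has_walk e 0 x x by apply/has_walkP; exists [::].
by rewrite leqn0 => /eqP->.
Qed.

(** An initial segment of a shortest walk is itself shortest, since a shortcut
to its endpoint would shorten the whole walk. *)
Lemma dist_initial (i n : nat) (x z : T) :
  dist e x z = Some n -> i <= n -> exists y, dist e x y = Some i.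
Proof.
move=> /dist_Some[xz min_n] le_in.
move: xz; rewrite -(subnKC le_in) => /has_walkD[y xy yz].
have [m xy_m le_mi] := dist_has_walk xy; exists y.
have [xy' _] := dist_Some xy_m.
have: n <= m + (n - i) by apply/min_n/has_walkD; exists y.
rewrite -{1}(subnKC le_in) leq_add2r => le_im.
by rewrite xy_m; congr Some; apply/eqP; rewrite eqn_leq le_mi.
Qed.

Lemma ltn_bigmax_ex (I : finType) (P : pred I) (F : I -> nat) (m : nat) :
  m < \max_(i | P i) F i -> exists i, m < F i.
Proof.
move=> lt_m; apply/existsP; apply: contraLR lt_m => /existsPn-le_F.
by rewrite -leqNgt; apply/bigmax_leqP => i _; rewrite leqNgt.
Qed.

(** The vertex [x0] is needed for [i = 0]: the diameter of the empty graph is 0,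
but no distance is realised there. *)
Lemma dist_surj (x0 : T) (i : nat) :
  i <= diameter e -> exists x y, dist e x y = Some i.
Proof.
case: i => [_ | i]; first by exists x0, x0; apply: dist_refl.
move=> /ltn_bigmax_ex[C] /ltn_bigmax_ex[x] /ltn_bigmax_ex[z].
by case xz: (dist e x z) => [n|] //= /(dist_initial xz)[y]; exists x, y.
Qed.

Lemma magic_nbhd0 (D : {pred nat}) (x y : T) :
  distance_magic e D -> nbhd e D x = set0 -> nbhd e D y = set0.
Proof.
move=> [f [[_ f_lab] [k f_magic]]] Dx0.
have f_gt0 z : 0 < f z.
  by have /andP[] : 1 <= f z <= #|T| by apply/f_lab; exists z.
have: \sum_(z in nbhd e D y) f z == 0.
  by rewrite f_magic -(f_magic x) Dx0 big_set0.
rewrite sum_nat_eq0 => /forallP f0; apply/setP => z; rewrite in_set0.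
by apply: contraTF (f0 z) => ->; rewrite -lt0n f_gt0.
Qed.

End Distance.

Theorem lemma5 (T : finType) (e : rel T)
    (e_sym : symmetric e) (e_irr : irreflexive e)
    (D : {pred nat})
    (D_le_diam : forall i : nat, i \in D -> i <= diameter e)
    (D_nonempty : exists i : nat, i \in D)
    (D_neq0 : ~ (D =i pred1 0))
    (x : T) (ND_x : nbhd e D x = set0) :
  ~ distance_magic e D.
Proof.
move=> magic; have [i Di] := D_nonempty.
have [y [z yz]] := dist_surj x (D_le_diam i Di).
have /setP/(_ z) := magic_nbhd0 y magic ND_x.
by rewrite !inE yz Di.
Qed.
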